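(* Strategy Logic $\mathsf{SL}$ admits no sound and complete effective axiomatization, even with effective $\omega$-rules: there is no effective axiomatic system with $\omega$-rules for $\mathsf{SL}$ formulas such that, for every $\mathsf{SL}$ sentence $\varphi$, $\varphi$ is provable in the system if and only if $\varphi$ is valid.
   Context: **Concurrent game structures.** A concurrent game structure (CGS) is a tuple $\mathcal G=\langle \mathrm{AP},\mathrm{Ag},\mathrm{Ac},\mathrm{St},\mathrm{tr},\mathrm{ap},s_0\rangle$ where $\mathrm{AP}$ (atomic propositions) and $\mathrm{Ag}$ (agents) are finite nonempty sets, $\mathrm{Ac}$ (actions) and $\mathrm{St}$ (states) are nonempty, at most countable sets, $s_0\in\mathrm{St}$ is the initial state, $\mathrm{tr}:\mathrm{St}\times\mathrm{Ac}^{\mathrm{Ag}}\to\mathrm{St}$ is the transition function, $\mathrm{ap}:\mathrm{St}\to 2^{\mathrm{AP}}$ is the labeling function. Elements of $\mathrm{Ac}^{\mathrm{Ag}}$ are decisions. A track (path) is a nonempty finite (respectively infinite) sequence of states $t_0t_1\ldots$ such that each consecutive pair satisfies $\mathrm{tr}(t_i,\delta_i)=t_{i+1}$ for some decision $\delta_i$. $\mathrm{Trk}$ is the set of tracks, $\mathrm{Trk}(s)$ the set of tracks starting with $s$. For a path $\pi=\pi_0\pi_1\ldots$, $\pi_{\le n}=\pi_0\ldots\pi_n$. If $\rho=t_0\ldots t_m$ and $\tau=t_m\ldots t_n$ are tracks, $\rho\star\tau=t_0\ldots t_n$. A strategy is a partial function $f:\mathrm{Trk}\rightharpoonup\mathrm{Ac}$;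 it is $s$-total if $\mathrm{Trk}(s)\subseteq\operatorname{dom}(f)$; $\mathrm{Str}(s)$ is the set of $s$-total strategies. The shift of $f$ along a track $\rho$ is $f_{\to\rho}(\tau):=f(\rho\star\tau)$ (defined when $\rho\star\tau$ is defined and lies in $\operatorname{dom}(f)$). **Syntax of $\mathsf{SL}$.** Let $\mathrm{Var}$ be a countably infinite set of strategy variables disjoint from $\mathrm{AP}$ and $\mathrm{Ag}$. Formulas over the signature $(\mathrm{AP},\mathrm{Ag})$: $$\varphi::=p\mid\neg\varphi\mid\varphi\wedge\varphi\mid\varphi\vee\varphi\mid\mathbf X\varphi\mid\varphi\,\mathsf U\,\varphi\mid\varphi\,\mathsf R\,\varphi\mid\langle\!\langle x\rangle\!\rangle\varphi\mid[\![x]\!]\varphi\mid(a,x)\varphi$$ with $p\in\mathrm{AP}$, $x\in\mathrm{Var}$, $a\in\mathrm{Ag}$. Free variables and agents: $\operatorname{free}(p)=\varnothing$; $\operatorname{free}(\neg\varphi)=\operatorname{free}(\varphi)$; $\operatorname{free}(\varphi\circ\psi)=\operatorname{free}(\varphi)\cup\operatorname{free}(\psi)$ for $\circ\in\{\wedge,\vee\}$; $\operatorname{free}(\mathbf X\varphi)=\mathrm{Ag}\cup\operatorname{free}(\varphi)$; $\operatorname{free}(\varphi\circ\psi)=\mathrm{Ag}\cup\operatorname{free}(\varphi)\cup\operatorname{free}(\psi)$ for $\circ\in\{\mathsf U,\mathsf R\}$; $\operatorname{free}(\langle\!\langle x\rangle\!\rangle\varphi)=\operatorname{free}([\![x]\!]\varphi)=\operatorname{free}(\varphi)\setminus\{x\}$;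 $\operatorname{free}((a,x)\varphi)=\operatorname{free}(\varphi)$ if $a\notin\operatorname{free}(\varphi)$, and $(\operatorname{free}(\varphi)\setminus\{a\})\cup\{x\}$ otherwise. A sentence is a formula $\varphi$ with $\operatorname{free}(\varphi)=\varnothing$. **Semantics.** An assignment is a partial map $\chi$ from $\mathrm{Var}\cup\mathrm{Ag}$ to strategies; it is complete if $\mathrm{Ag}\subseteq\operatorname{dom}(\chi)$, and $s$-total if all its values are $s$-total. $\chi[\ell\mapsto f]$ is the update of $\chi$; $\chi_{\to\rho}$ is obtained by shifting all values along $\rho$. For complete $s$-total $\chi$, the $(\chi,s)$-play is the path $\pi$ with $\pi_0=s$ and $\pi_{i+1}=\mathrm{tr}(\pi_i,\delta_i)$, $\delta_i(a)=\chi(a)(\pi_{\le i})$; put $(\chi,s)^i=(\chi_{\to\pi_{\le i}},\pi_i)$. For $s$-total $\chi$ with $\operatorname{free}(\varphi)\subseteq\operatorname{dom}(\chi)$, define $\mathcal G,\chi,s\models\varphi$ by: Boolean clauses as usual; $\mathcal G,\chi,s\models p$ iff $p\in\mathrm{ap}(s)$; $\mathcal G,\chi,s\models\langle\!\langle x\rangle\!\rangle\psi$ (resp. $[\![x]\!]\psi$) iff for some (resp. every) $f\in\mathrm{Str}(s)$, $\mathcal G,\chi[x\mapsto f],s\models\psi$; $\mathcal G,\chi,s\models(a,x)\psi$ iff $\mathcal G,\chi[a\mapsto\chi(x)],s\models\psi$ (and, if $a\notin\operatorname{free}(\psi)$, simply iff $\mathcal G,\chi,s\models\psi$); and for complete $\chi$: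 $\mathbf X\psi$ holds iff $\mathcal G,(\chi,s)^1\models\psi$; $\psi_1\mathsf U\psi_2$ holds iff $\exists i\,(\mathcal G,(\chi,s)^i\models\psi_2$ and $\forall j<i\ \mathcal G,(\chi,s)^j\models\psi_1)$; $\psi_1\mathsf R\psi_2$ holds iff $\forall i\,(\mathcal G,(\chi,s)^i\models\psi_2$ or $\exists j<i\ \mathcal G,(\chi,s)^j\models\psi_1)$. A sentence $\varphi$ over $(\mathrm{AP},\mathrm{Ag})$ is valid if $\mathcal G,\varnothing,s_0\models\varphi$ for every CGS $\mathcal G$ with these $\mathrm{AP},\mathrm{Ag}$. **Coding and effective axiomatic systems.** $\mathrm{AP}$ and $\mathrm{Ag}$ are finite nonempty subsets of fixed countably infinite supplies; formulas are given together with their signature $(\mathrm{AP},\mathrm{Ag})$ and coded by natural numbers via a fixed standard Gödel numbering. An effective axiomatic system with $\omega$-rules consists of a computably enumerable set $\mathcal A$ of formulas (axioms), a computably enumerable set $W$ of pairs $(k,\varphi)$ with $k\in\mathbb N$ and $\varphi$ a formula (meaning ''rule number $k$ can be applied with conclusion $\varphi$''), and a partial computable function $r$ such that for every $(k,\varphi)\in W$ and $n\in\mathbb N$ the value $r(k,\varphi,n)$ is defined and is a formula (the $n$-th premise of the rule with the given conclusion; finitary rules are the case in which only finitely many distinct premises occur). The set of provable formulas is the least set of formulas containing $\mathcal A$ and containing $\varphi$ whenever $(k,\varphi)\in W$ and all premises $r(k,\varphi,n)$, $n\in\mathbb N$, belong to it. *)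

(* Defs.v *)
From HB Require Import structures.
From mathcomp Require Import all_boot finmap.
From Stdlib Require Cantor.

Set Implicit Arguments.
Unset Strict Implicit.
Unset Printing Implicit Defensive.

(* The countably infinite supplies of atomic propositions and of agents are
   two copies of [nat]; so is the set of strategy variables. They are kept
   disjoint by typing. *)
Record signature := Signature {
  props : {fset nat};
  agents : {fset nat};
  props_neq0 : props != fset0;
  agents_neq0 : agents != fset0 }.

Inductive formula (S : signature) : Type :=
| Atom of props S
| Not of formula S
| And of formula S & formula S
| Or of formula S & formula S
| Next of formula S
| Until of formula S & formula S
| Release of formula S & formula S
| ExistsStr of nat & formula S
| ForallStr of nat & formula S
| Bind of agents S & nat & formula S.

(* The disjoint union of Var and Ag. *)
Definition label (S : signature) := (nat + agents S)%type.

Definition is_agent S (l : label S) : bool := if l is inr _ then true else false.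

Fixpoint free S (phi : formula S) (l : label S) : bool :=
  match phi with
  | Atom _ => false
  | Not phi1 => free phi1 l
  | And phi1 phi2 | Or phi1 phi2 => free phi1 l || free phi2 l
  | Next phi1 => is_agent l || free phi1 l
  | Until phi1 phi2 | Release phi1 phi2 =>
      [|| is_agent l, free phi1 l | free phi2 l]
  | ExistsStr x phi1 | ForallStr x phi1 => free phi1 l && (l != inl x)
  | Bind a x phi1 =>
      if free phi1 (inr a) then (free phi1 l && (l != inr a)) || (l == inl x)
      else free phi1 l
  end.

Definition sentence S (phi : formula S) : Prop := forall l, ~~ free phi l.

Record cgs (S : signature) := CGS {
  action : countType;
  state : countType;
  action_nonempty : inhabited action;
  trans : state -> {ffun agents S -> action} -> state;
  labeling : state -> {set props S};
  init : state }.

Section Semantics.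
Variables (S : signature) (G : cgs S).
Local Notation St := (state G).
Local Notation Ac := (action G).

Definition step (s t : St) : Prop := exists delta, trans s delta = t.

Fixpoint chain (s : St) (p : seq St) : Prop :=
  if p is t :: p' then step s t /\ chain t p' else True.

Definition track (rho : seq St) : Prop :=
  if rho is s :: p then chain s p else False.

Definition track_from (s : St) (rho : seq St) : Prop :=
  track rho /\ ohead rho = Some s.

(* [glue rho tau] is the composition of rho and tau along the last state of
   rho, which has to be the first state of tau. *)
Definition glue (rho tau : seq St) : option (seq St) :=
  match rho, tau with
  | r :: rho', t :: tau' => if last r rho' == t then Some (rho ++ tau') else None
  | _, _ => None
  end.

(* A partial function on tracks is a map to [option] that is [None] outside
   the tracks; this side condition is part of [total_strategy], hence holds
   for every value that a strategy quantifier ranges over, and [shift]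
   preserves it. *)
Definition strategy := seq St -> option Ac.

Definition total_strategy (s : St) (f : strategy) : Prop :=
  (forall rho, f rho -> track rho) /\ (forall rho, track_from s rho -> f rho).

Definition shift (rho : seq St) (f : strategy) : strategy :=
  fun tau => obind f (glue rho tau).

Definition assignment := label S -> option strategy.

Definition empty_assignment : assignment := fun=> None.

Definition update (chi : assignment) (l : label S) (f : option strategy) :
  assignment := fun l' => if l' == l then f else chi l'.

Definition shift_assignment (rho : seq St) (chi : assignment) : assignment :=
  fun l => omap (shift rho) (chi l).

Definition prefix_upto (pi : nat -> St) (n : nat) : seq St := mkseq pi n.+1.

(* For complete s-total chi there is exactly one such pi. *)
Definition is_play (chi : assignment) (s : St) (pi : nat -> St) : Prop :=
  pi 0 = s /\
  forall i, exists delta : {ffun agents S -> Ac},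
    (forall a, obind (fun f => f (prefix_upto pi i)) (chi (inr a))
               = Some (delta a)) /\
    pi i.+1 = trans (pi i) delta.

(* Meaningful for s-total chi defined on the free variables and agents of
   phi; the recursive calls stay within this domain. *)
Fixpoint sat (chi : assignment) (s : St) (phi : formula S) : Prop :=
  match phi with
  | Atom p => p \in labeling s
  | Not phi1 => ~ sat chi s phi1
  | And phi1 phi2 => sat chi s phi1 /\ sat chi s phi2
  | Or phi1 phi2 => sat chi s phi1 \/ sat chi s phi2
  | Next phi1 =>
      exists2 pi, is_play chi s pi &
        sat (shift_assignment (prefix_upto pi 1) chi) (pi 1) phi1
  | Until phi1 phi2 =>
      exists2 pi, is_play chi s pi &
        exists i,
          sat (shift_assignment (prefix_upto pi i) chi) (pi i) phi2 /\
          forall j, j < i ->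
            sat (shift_assignment (prefix_upto pi j) chi) (pi j) phi1
  | Release phi1 phi2 =>
      exists2 pi, is_play chi s pi &
        forall i,
          sat (shift_assignment (prefix_upto pi i) chi) (pi i) phi2 \/
          exists2 j, j < i &
            sat (shift_assignment (prefix_upto pi j) chi) (pi j) phi1
  | ExistsStr x phi1 =>
      exists2 f, total_strategy s f &
        sat (update chi (inl x) (Some f)) s phi1
  | ForallStr x phi1 =>
      forall f, total_strategy s f ->
        sat (update chi (inl x) (Some f)) s phi1
  | Bind a x phi1 =>
      if free phi1 (inr a) then sat (update chi (inr a) (chi (inl x))) s phi1
      else sat chi s phi1
  end.

End Semantics.

Definition valid S (phi : formula S) : Prop :=
  forall G : cgs S, sat (@empty_assignment S G) (init G) phi.

(* A formula together with its signature. *)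
Definition sl_formula := {S : signature & formula S}.

Definition pair_code (m n : nat) : nat := Cantor.to_nat (m, n).

(* Canonical index of a finite set of natural numbers. *)
Definition fset_code (A : {fset nat}) : nat := \sum_(i <- A) 2 ^ i.

Fixpoint formula_code S (phi : formula S) : nat :=
  match phi with
  | Atom p => pair_code 0 (val p)
  | Not phi1 => pair_code 1 (formula_code phi1)
  | And phi1 phi2 =>
      pair_code 2 (pair_code (formula_code phi1) (formula_code phi2))
  | Or phi1 phi2 =>
      pair_code 3 (pair_code (formula_code phi1) (formula_code phi2))
  | Next phi1 => pair_code 4 (formula_code phi1)
  | Until phi1 phi2 =>
      pair_code 5 (pair_code (formula_code phi1) (formula_code phi2))
  | Release phi1 phi2 =>
      pair_code 6 (pair_code (formula_code phi1) (formula_code phi2))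
  | ExistsStr x phi1 => pair_code 7 (pair_code x (formula_code phi1))
  | ForallStr x phi1 => pair_code 8 (pair_code x (formula_code phi1))
  | Bind a x phi1 =>
      pair_code 9 (pair_code (val a) (pair_code x (formula_code phi1)))
  end.

Definition godel (phi : sl_formula) : nat :=
  pair_code
    (pair_code (fset_code (props (tag phi))) (fset_code (agents (tag phi))))
    (formula_code (tagged phi)).

(* Kleene's mu-recursive functions of n arguments. *)
Inductive murec : nat -> Type :=
| MZero n : murec n
| MSucc : murec 1
| MProj n : 'I_n -> murec n
| MComp n k : murec k -> ('I_k -> murec n) -> murec n
| MPrec n : murec n -> murec n.+2 -> murec n.+1
| MMin n : murec n.+1 -> murec n.

(* [prec_graph F H t m v]: v is the value at m of the function defined by
   primitive recursion from the graphs F and H, with parameters t; the step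
   function takes the recursion index, the previous value, then t. *)
Fixpoint prec_graph n (F : n.-tuple nat -> nat -> Prop)
    (H : n.+2.-tuple nat -> nat -> Prop) (t : n.-tuple nat) (m v : nat) : Prop :=
  if m is m'.+1 then
    exists2 w, prec_graph F H t m' w & H [tuple of m' :: w :: t] v
  else F t v.

(* [meval e t v]: the partial function e is defined at t, with value v. *)
Fixpoint meval n (e : murec n) : n.-tuple nat -> nat -> Prop :=
  match e in murec n return n.-tuple nat -> nat -> Prop with
  | MZero _ => fun _ v => v = 0
  | MSucc => fun t v => v = (thead t).+1
  | MProj _ i => fun t v => v = tnth t i
  | MComp _ k f g => fun t v =>
      exists2 u : k.-tuple nat,
        (forall i, meval (g i) t (tnth u i)) & meval f u v
  | MPrec _ f h => fun t v =>
      prec_graph (meval f) (meval h) (behead_tuple t) (thead t) v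
  | MMin _ f => fun t v =>
      meval f [tuple of v :: t] 0 /\
      forall m, m < v -> exists w, meval f [tuple of m :: t] w.+1
  end.

Definition partial_computable n (R : n.-tuple nat -> nat -> Prop) : Prop :=
  exists e : murec n, forall t v, R t v <-> meval e t v.

Definition comp_enumerable n (A : n.-tuple nat -> Prop) : Prop :=
  exists e : murec n, forall t, A t <-> exists v, meval e t v.

(* [premise] is the graph of the partial function r, on codes. *)
Record effective_system := EffectiveSystem {
  axiom : sl_formula -> Prop;
  rule : nat -> sl_formula -> Prop;
  premise : 3.-tuple nat -> nat -> Prop;
  axiom_ce : comp_enumerable (fun t : 1.-tuple nat =>
    exists2 phi, axiom phi & t = [tuple godel phi]);
  rule_ce : comp_enumerable (fun t : 2.-tuple nat =>
    exists k, exists2 phi, rule k phi & t = [tuple k; godel phi]);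
  premise_computable : partial_computable premise;
  premise_defined : forall k phi, rule k phi -> forall n,
    exists psi, premise [tuple k; godel phi; n] (godel psi) }.

Inductive provable (E : effective_system) : sl_formula -> Prop :=
| provable_axiom phi : axiom E phi -> provable E phi
| provable_rule k phi : rule E k phi ->
    (forall n psi, premise E [tuple k; godel phi; n] (godel psi) -> provable E psi) ->
    provable E phi.

(* Main.v *)
Require Import Defs.
From mathcomp Require Import all_boot finmap.
From mathcomp Require Import boolp.
From Stdlib Require Cantor.

Set Implicit Arguments.
Unset Strict Implicit.
Unset Printing Implicit Defensive.

(** Strategies range over arbitrary functions of the history, so a strategy
    codes both a number (its first action) and a binary relation (its answers in
    the state reached when two agents first play a pair of numbers). Hence there
    is a sentence forcing the strategies of a concurrent game structure to behave
    like the numbers and all the binary relations on them, and validity in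
    Strategy Logic interprets full second-order arithmetic. The set of theorems
    of an effective system with omega-rules is the least set closed under
    arithmetical rules, hence definable in second-order arithmetic, and the
    diagonal lemma yields a sentence that is valid if and only if it is not
    provable. *)

(** * Injectivity of the Goedel numbering *)

Lemma pair_code_inj m n m' n' :
  pair_code m n = pair_code m' n' -> m = m' /\ n = n'.
Proof.
move=> /(congr1 Cantor.of_nat); rewrite !Cantor.cancel_of_to.
by case.
Qed.

(** Splitting off the exponent 0 leaves twice a sum of the same shape, so induction on [i] strips
    one binary digit at a time. *)
Lemma sum_pow2_bit (i : nat) (s : seq nat) : uniq s ->
  odd ((\sum_(j <- s) 2 ^ j) %/ 2 ^ i) = (i \in s).
Proof.
have split0 (r : seq nat) : uniq r ->
    \sum_(j <- r) 2 ^ j =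
    (0 \in r) + (\sum_(j <- [seq j.-1 | j <- r & 0 < j]) 2 ^ j).*2.
  move=> r_uniq; rewrite (bigID (pred1 0)) /= big_map big_filter; congr (_ + _).
    rewrite -big_filter; case: (boolP (0 \in r)) => r0.
      by rewrite filter_pred1_uniq // big_seq1.
    rewrite big_filter big_seq_cond big_pred0 // => j.
    by case: eqP => [->|]; rewrite ?andbF // (negPf r0).
  rewrite -muln2 big_distrl /=; apply: eq_big => [j|[|j] //= _].
    by rewrite lt0n.
  by rewrite expnSr.
elim: i s => [|i IHi] s s_uniq.
  by rewrite divn1 split0 // oddD odd_double addbF; case: (0 \in s).
rewrite expnS divnMA split0 // divn2 half_bit_double IHi.
  apply/mapP/idP => [[j]|si].
    by rewrite mem_filter => /andP[j_gt0 js ->]; rewrite prednK.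
  by exists i.+1; rewrite ?mem_filter.
rewrite map_inj_in_uniq ?filter_uniq // => j j'.
by rewrite !mem_filter => /andP[j0 _] /andP[j0' _]; case: j j' j0 j0' => // j [|j'] //= _ _ ->.
Qed.

Lemma fset_code_inj : injective fset_code.
Proof.
move=> A B eqAB; apply/fsetP => i.
by rewrite -[LHS]sum_pow2_bit ?fset_uniq // -[RHS]sum_pow2_bit ?fset_uniq // -/(fset_code A) eqAB.
Qed.

Lemma formula_code_inj S : injective (@formula_code S).
Proof.
elim=> [p|f IHf|f IHf g IHg|f IHf g IHg|f IHf|f IHf g IHg|f IHf g IHg|x f IHf
       |x f IHf|a x f IHf] [p'|f'|f' g'|f' g'|f'|f' g'|f' g'|x' f'|x' f'|a' x' f'] /=;
  move=> /pair_code_inj[] //= _.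
- by move=> /val_inj ->.
- by move=> /IHf ->.
- by move=> /pair_code_inj[/IHf -> /IHg ->].
- by move=> /pair_code_inj[/IHf -> /IHg ->].
- by move=> /IHf ->.
- by move=> /pair_code_inj[/IHf -> /IHg ->].
- by move=> /pair_code_inj[/IHf -> /IHg ->].
- by move=> /pair_code_inj[-> /IHf ->].
- by move=> /pair_code_inj[-> /IHf ->].
- by move=> /pair_code_inj[/val_inj -> /pair_code_inj[-> /IHf ->]].
Qed.

Lemma godel_inj : injective godel.
Proof.
move=> [[P A P0 A0] f] [[P' A' P0' A0'] g] /pair_code_inj /= [/pair_code_inj[]].
move=> /fset_code_inj eqP /fset_code_inj eqA; subst P' A'.
rewrite (bool_irrelevance P0' P0) (bool_irrelevance A0' A0) in g *.
by move=> /formula_code_inj ->.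
Qed.

(** * Provability as membership in a least closed set of codes *)

Lemma meval_functional n (e : murec n) t v v' :
  meval e t v -> meval e t v' -> v = v'.
Proof.
elim: e t v v' => {n} [n|/=|n i|n k f IHf g IHg|n f IHf h IHh|n f IHf] t v v' /=;
  try by move=> -> ->.
- move=> [u gu fu] [u' gu' fu'].
  suff eq_u : u = u' by apply: IHf fu _; rewrite eq_u.
  by apply: eq_from_tnth => i; apply: IHg (gu i) (gu' i).
- elim: (thead t) v v' => [|m IHm] v v' /=; first exact: IHf.
  move=> [w mw hw] [w' mw' hw'].
  by rewrite (IHm _ _ mw' mw) in hw'; apply: IHh hw hw'.
(* If two minima differed, the smaller would receive 0 from its own search and a successor from the
   other one. *)
- move=> [v0 lt_v] [v0' lt_v']; case: (ltngtP v v') => // ltv.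
    by have [w /(IHf _ _ _ v0)] := lt_v' _ ltv.
  by have [w /(IHf _ _ _ v0')] := lt_v _ ltv.
Qed.

Section Provability.
Variable E : effective_system.
Variables (ax : murec 1) (ru : murec 2) (pr : murec 3).

(** Sets appear as diagonals of binary relations, because binary relations are what second-order
    quantifiers of the standard structure range over. *)
Definition in_least_closed (c : nat) : Prop :=
  forall R : nat -> nat -> Prop,
    (forall n, (exists v, meval ax [tuple n] v) -> R n n) ->
    (forall k n, (exists v, meval ru [tuple k; n] v) ->
       (forall j v, meval pr [tuple k; n; j] v -> R v v) -> R n n) ->
    R c c.

Hypothesis axP : forall t : 1.-tuple nat,
  (exists2 phi, axiom E phi & t = [tuple godel phi]) <-> exists v, meval ax t v.
Hypothesis ruP : forall t : 2.-tuple nat,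
  (exists k, exists2 phi, rule E k phi & t = [tuple k; godel phi])
    <-> exists v, meval ru t v.
Hypothesis prP : forall t v, premise E t v <-> meval pr t v.

(** From right to left, the closed set is that of the codes of provable formulas; injectivity of
    [godel] leads back from codes to formulas. *)
Lemma provableP phi : provable E phi <-> in_least_closed (godel phi).
Proof.
split=> [prov R Rax Rru|].
  elim: prov => {phi} [phi phi_ax|k phi k_phi _ IH].
    by apply/Rax/axP; exists phi.
  apply: (Rru k); first by apply/ruP; exists k, phi.
  (* Any value of [pr] here codes a formula: [premise_defined] provides such a value, and values are
     unique. *)
  move=> j v jv; have [psi psiP] := premise_defined k_phi j.
  rewrite (meval_functional jv (iffLR (prP _ _) psiP)).
  exact: IH psiP.
move=> /(_ (fun n _ => exists2 psi, provable E psi & n = godel psi)) [||psi prov_psi].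
- move=> n /axP[psi psi_ax eq_n]; exists psi; first exact: provable_axiom.
  by have := congr1 (fun t => thead t) eq_n.
- move=> k n /ruP[k' [psi psi_ru eq_kn]] prem.
  have [eq_k eq_n] : k = k' /\ n = godel psi.
    by case: (congr1 val eq_kn).
  subst k' n; exists psi => //; apply: provable_rule psi_ru _ => j psi' /prP.
  by move=> /prem[psi'' ? /godel_inj ->].
- by move=> /godel_inj ->.
Qed.

End Provability.

(** * First-order formulas and their invariance under bisimulation *)

(* One-sorted first-order formulas in de Bruijn notation. An element of a
   structure is at once an individual and a binary relation on individuals:
   [FApp r x y] says that x and y are related by r, [FSucc x y] that they are
   related by the distinguished element s. *)
Inductive fo : Type :=
| FApp of nat & nat & nat
| FSucc of nat & nat
| FNot of fo
| FAnd of fo & fo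
| FImp of fo & fo
| FAll of fo
| FEx of fo.

Definition scons T (x : T) (e : nat -> T) (i : nat) : T :=
  if i is i'.+1 then e i' else x.

Fixpoint eval M (App : M -> M -> M -> Prop) (s : M) (e : nat -> M) (f : fo) : Prop :=
  match f with
  | FApp r x y => App (e r) (e x) (e y)
  | FSucc x y => App s (e x) (e y)
  | FNot f1 => ~ eval App s e f1
  | FAnd f1 f2 => eval App s e f1 /\ eval App s e f2
  | FImp f1 f2 => eval App s e f1 -> eval App s e f2
  | FAll f1 => forall m, eval App s (scons m e) f1
  | FEx f1 => exists m, eval App s (scons m e) f1
  end.

Definition std : Type := (nat * (nat -> nat -> Prop))%type.
Definition std_app (r x y : std) : Prop := r.2 x.1 y.1.
Definition std_succ : std := (0, fun x y => y = x.+1).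

(** A relation rather than a map: several elements may carry the same number and relation, and the
    language has no equality to tell them apart. *)
Record bisimulation M (App : M -> M -> M -> Prop) (s : M) (I : M -> std -> Prop) : Prop :=
  Bisimulation {
    bisim_left : forall m, exists m0, I m m0;
    bisim_right : forall m0, exists m, I m m0;
    bisim_app : forall r r0 x x0 y y0, I r r0 -> I x x0 -> I y y0 ->
      (App r x y <-> std_app r0 x0 y0);
    bisim_succ : forall x x0 y y0, I x x0 -> I y y0 ->
      (App s x y <-> std_app std_succ x0 y0) }.

Lemma eval_bisim M (App : M -> M -> M -> Prop) s I (B : bisimulation App s I) e e0 f :
  (forall i, I (e i) (e0 i)) ->
  (eval App s e f <-> eval std_app std_succ e0 f).
Proof.
have Icons m m0 e' e0' : I m m0 -> (forall i, I (e' i) (e0' i)) ->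
  forall i, I (scons m e' i) (scons m0 e0' i) by move=> ? ? [].
elim: f e e0 => [r x y|x y|f IHf|f IHf g IHg|f IHf g IHg|f IHf|f IHf] e e0 Ie /=.
- exact: (bisim_app B).
- exact: (bisim_succ B).
- by rewrite (IHf _ _ Ie).
- by rewrite (IHf _ _ Ie) (IHg _ _ Ie).
- by rewrite (IHf _ _ Ie) (IHg _ _ Ie).
- split=> H m; [have [m' Im] := bisim_right B m|have [m' Im] := bisim_left B m];
    exact/(IHf _ _ (Icons _ _ _ _ Im Ie)).
- split=> -[m Hm]; [have [m' Im] := bisim_left B m|have [m' Im] := bisim_right B m];
    exists m'; exact/(IHf _ _ (Icons _ _ _ _ Im Ie)).
Qed.

(** * Second-order Peano axioms *)

Section Peano.
Variables (M : Type) (App : M -> M -> M -> Prop) (s : M).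

Definition zero_elt x := forall y, ~ App s y x.
(** Equality of numbers, expressed by a common successor; this builds in the injectivity of the
    successor. *)
Definition eqv x y := exists w, App s x w /\ App s y w.

(** The first two clauses are the hypotheses of [relation_full], the third equates pairs that no
    relation separates, and the last lets one element combine a given number with a given
    relation. *)
Definition peano : Prop :=
  (exists r, forall x y, App r x y) /\
  (exists r, forall x y, ~ App r x y) /\
  (forall x y x' y',
     (forall r, (App r x y -> App r x' y') /\ (App r x' y' -> App r x y)) ->
     eqv x x' /\ eqv y y') /\
  (forall r x x' y y', eqv x x' -> eqv y y' -> App r x y -> App r x' y') /\
  (exists x, zero_elt x) /\
  (forall x y, zero_elt x -> zero_elt y -> eqv x y) /\
  (forall x, exists y, App s x y) /\
  (forall x y z, App s x y -> App s x z -> eqv y z) /\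
  (forall r, (forall x, zero_elt x -> App r x x) ->
     (forall x y, App r x x -> App s x y -> App r y y) -> forall x, App r x x) /\
  (forall x r, exists m, eqv m x /\
     forall y z, (App m y z -> App r y z) /\ (App r y z -> App m y z)).

(** Comprehension for all predicates of the metatheory, which no first-order axiom can express and
    which strategies will provide. [Q] has to respect indistinguishable pairs, as every relation of
    the structure does. *)
Definition relation_full : Prop :=
  (exists r, forall x y, App r x y) -> (exists r, forall x y, ~ App r x y) ->
  forall Q : M -> M -> Prop,
    (forall x y x' y',
       (forall r, (App r x y -> App r x' y') /\ (App r x' y' -> App r x y)) ->
       Q x y -> Q x' y') ->
  exists r, forall x y, App r x y <-> Q x y.

Fixpoint denotes (x : M) (n : nat) : Prop :=
  if n is n'.+1 then exists2 y, denotes y n' & App s y x else zero_elt x.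

Definition std_rel (m : M) (m0 : std) : Prop :=
  denotes m m0.1 /\
  forall x y nx ny, denotes x nx -> denotes y ny -> (App m x y <-> m0.2 nx ny).

Lemma peano_bisimulation : peano -> relation_full -> bisimulation App s std_rel.
Proof.
move=> [all_r [no_r [sep [cong [[z z0] [zero_uniq [succ_ex [succ_fun [ind joint]]]]]]]]].
move=> /(_ all_r no_r) full.
have eqv_refl x : eqv x x by have [y xy] := succ_ex x; exists y.
have eqv_sym x y : eqv x y -> eqv y x by move=> [w [? ?]]; exists w.
have den_eqv x y n : eqv x y -> denotes x n -> denotes y n.
  move=> xy; case: n => [|n] /=.
    by move=> x0 u uy; apply: (x0 u); apply: cong uy => //; apply: eqv_sym.
  by move=> [u un ux]; exists u => //; apply: cong ux.
have eqv_den n x y : denotes x n -> denotes y n -> eqv x y.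
  elim: n x y => [|n IHn] x y /=; first exact: zero_uniq.
  move=> [u un ux] [v vn vy]; apply: (succ_fun u) => //.
  by apply: cong vy => //; apply: IHn.
have den_fun x n n' : denotes x n -> denotes x n' -> n = n'.
  elim: n x n' => [|n IHn] x [|n'] //=.
  - by move=> x0 [u _ /x0].
  - by move=> [u _ ux] /(_ _ ux).
  - move=> [u un ux] [v vn vx]; congr _.+1; apply: (IHn u) => //.
    by apply: den_eqv vn; exists x.
have den_surj n : exists x, denotes x n.
  elim: n => [|n [x xn]]; first by exists z.
  by have [y xy] := succ_ex x; exists y, x.
(* Comprehension turns the property of denoting a number into the diagonal of an element, to which
   the induction axiom applies. *)
have den_total x : exists n, denotes x n.
  have [|r rP] := full (fun x y => eqv x y /\ exists n, denotes x n).
    move=> a b a' b' /sep[aa' bb'] [[w [aw bw]] [n an]]; split; last by exists n; apply: den_eqv an.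
    by exists w; split; [apply: cong aw|apply: cong bw].
  apply: (iffLR (rP x x) _).2; apply: ind.
    by move=> y y0; apply/rP; split=> //; exists 0.
  by move=> y u /rP[_ [n yn]] yu; apply/rP; split=> //; exists n.+1, y.
split.
- move=> m; have [n mn] := den_total m.
  exists (n, fun i j => exists x y, [/\ denotes x i, denotes y j & App m x y]); split=> //= x y i j xi yj.
  split=> [|[x' [y' [x'i y'j]]]]; first by exists x, y.
  by apply: cong; [apply: eqv_den x'i xi|apply: eqv_den y'j yj].
- move=> [n r0]; have [x xn] := den_surj n.
  have [|r rP] := full (fun x y => exists i j, [/\ denotes x i, denotes y j & r0 i j]).
    move=> a b a' b' /sep[aa' bb'] [i [j [ai bj rij]]].
    by exists i, j; split=> //; [apply: den_eqv ai|apply: den_eqv bj].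
  (* Comprehension gave the relation; the last axiom attaches it to the number denoted by [x]. *)
  have [m [mx mr]] := joint x r; exists m; split=> /=; first by apply: den_eqv xn; apply: eqv_sym.
  move=> u v i j ui vj; split=> [/(mr _ _).1/rP[i' [j' [ui' vj']]]|rij].
    by rewrite (den_fun _ _ _ ui ui') (den_fun _ _ _ vj vj').
  by apply: (mr _ _).2; apply/rP; exists i, j.
- by move=> r r0 x x0 y y0 [_ rP] [xP _] [yP _]; apply: rP.
- move=> x x0 y y0 [xP _] [yP _]; split=> [xy|/= ey].
    by apply: (den_fun y) => //=; exists x.
  move: yP; rewrite ey => -[u ux uy]; apply: cong uy => //.
  exact: eqv_den ux xP.
Qed.

End Peano.

Definition zero_fo (i : nat) := FAll (FNot (FSucc 0 i.+1)).
Definition eqv_fo (i j : nat) := FEx (FAnd (FSucc i.+1 0) (FSucc j.+1 0)).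
Definition same_fo (f g : fo) := FAnd (FImp f g) (FImp g f).

Definition peano_fo : fo :=
  FAnd (FEx (FAll (FAll (FApp 2 1 0))))
 (FAnd (FEx (FAll (FAll (FNot (FApp 2 1 0)))))
 (FAnd (FAll (FAll (FAll (FAll (FImp
          (FAll (same_fo (FApp 0 4 3) (FApp 0 2 1)))
          (FAnd (eqv_fo 3 1) (eqv_fo 2 0)))))))
 (FAnd (FAll (FAll (FAll (FAll (FAll (FImp (eqv_fo 3 2) (FImp (eqv_fo 1 0)
          (FImp (FApp 4 3 1) (FApp 4 2 0)))))))))
 (FAnd (FEx (zero_fo 0))
 (FAnd (FAll (FAll (FImp (zero_fo 1) (FImp (zero_fo 0) (eqv_fo 1 0)))))
 (FAnd (FAll (FEx (FSucc 1 0)))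
 (FAnd (FAll (FAll (FAll (FImp (FSucc 2 1) (FImp (FSucc 2 0) (eqv_fo 1 0))))))
 (FAnd (FAll (FImp (FAll (FImp (zero_fo 0) (FApp 1 0 0)))
             (FImp (FAll (FAll (FImp (FApp 2 1 1) (FImp (FSucc 1 0) (FApp 2 0 0)))))
                   (FAll (FApp 1 0 0)))))
       (FAll (FAll (FEx (FAnd (eqv_fo 0 2)
          (FAll (FAll (same_fo (FApp 2 1 0) (FApp 3 1 0)))))))))))))))).

Lemma eval_peano M (App : M -> M -> M -> Prop) s e :
  eval App s e peano_fo = peano App s.
Proof. by []. Qed.

Lemma std_eqv (x y : std) : eqv std_app std_succ x y <-> x.1 = y.1.
Proof.
split=> [[w [/= -> []]] //|eq_xy].
by exists (x.1.+1, fun _ _ => True); rewrite /std_app /= eq_xy.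
Qed.

Lemma std_zero (x : std) : zero_elt std_app std_succ x <-> x.1 = 0.
Proof.
split=> [|x0 y]; last by rewrite /std_app /= x0.
case: x => -[|n] r //= /(_ (n, r)) H; case: H.
by rewrite /std_app /=.
Qed.

Lemma std_peano : peano std_app std_succ.
Proof.
rewrite /peano.
split; [|split; [|split; [|split; [|split; [|split; [|split; [|split; [|split]]]]]]]].
- by exists (0, fun _ _ => True); rewrite /std_app.
- by exists (0, fun _ _ => False) => x y [].
- move=> x y x' y' /(_ (0, fun a b => a = x.1 /\ b = y.1)).
  by move=> [/(_ (conj erefl erefl))[ex ey] _]; split; apply/std_eqv.
- by move=> r x x' y y' /std_eqv + /std_eqv; rewrite /std_app => -> ->.
- by exists (0, fun _ _ => True); apply/std_zero.
- by move=> x y /std_zero x0 /std_zero y0; apply/std_eqv; rewrite x0 y0.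
- by move=> x; exists (x.1.+1, fun _ _ => True).
- by move=> x y z /= xy xz; apply/std_eqv; rewrite xy xz.
- move=> r r0 rS [n q]; rewrite /std_app /=.
  elim: n => [|n IHn]; first by apply: (r0 (0, q)); apply/std_zero.
  exact: (rS (n, q) (n.+1, q) IHn erefl).
- by move=> x r; exists (x.1, r.2); split=> //; apply/std_eqv.
Qed.

(** * Definability in the standard structure *)

(** Stated for predicates of the environment, so that arithmetization proceeds by closure properties
    without displaying formulas. *)
Definition definable (P : (nat -> std) -> Prop) : Prop :=
  exists f, forall e, eval std_app std_succ e f <-> P e.

Section Closure.
Implicit Types P Q : (nat -> std) -> Prop.

Lemma definable_ext P Q : (forall e, P e <-> Q e) -> definable P -> definable Q.
Proof. by move=> PQ [f fP]; exists f => e; rewrite fP. Qed.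

Lemma definable_not P : definable P -> definable (fun e => ~ P e).
Proof. by move=> [f fP]; exists (FNot f) => e /=; rewrite fP. Qed.

Lemma definable_and P Q :
  definable P -> definable Q -> definable (fun e => P e /\ Q e).
Proof. by move=> [f fP] [g gQ]; exists (FAnd f g) => e /=; rewrite fP gQ. Qed.

Lemma definable_imp P Q :
  definable P -> definable Q -> definable (fun e => P e -> Q e).
Proof. by move=> [f fP] [g gQ]; exists (FImp f g) => e /=; rewrite fP gQ. Qed.

Lemma definable_all (P : std -> (nat -> std) -> Prop) :
  definable (fun e => P (e 0) (fun i => e i.+1)) ->
  definable (fun e => forall m, P m e).
Proof.
move=> [f fP]; exists (FAll f) => e /=.
by split=> H m; [apply: (iffLR (fP (scons m e)) (H m))|apply: (iffRL (fP (scons m e)) (H m))].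
Qed.

Lemma definable_ex (P : std -> (nat -> std) -> Prop) :
  definable (fun e => P (e 0) (fun i => e i.+1)) ->
  definable (fun e => exists m, P m e).
Proof.
move=> [f fP]; exists (FEx f) => e /=.
by split=> -[m H]; exists m;
  [apply: (iffLR (fP (scons m e)) H)|apply: (iffRL (fP (scons m e)) H)].
Qed.

Lemma definable_all_num (P : nat -> (nat -> std) -> Prop) :
  definable (fun e => P (e 0).1 (fun i => e i.+1)) ->
  definable (fun e => forall n, P n e).
Proof.
move=> /(definable_all (P := fun m => P m.1)); apply: definable_ext => e.
by split=> [H n|H [n r]]; [apply: (H (n, fun _ _ => True))|apply: H].
Qed.

Lemma definable_ex_num (P : nat -> (nat -> std) -> Prop) :
  definable (fun e => P (e 0).1 (fun i => e i.+1)) ->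
  definable (fun e => exists n, P n e).
Proof.
move=> /(definable_ex (P := fun m => P m.1)); apply: definable_ext => e.
by split=> [[[n r] ?]|[n ?]]; [exists n|exists (n, fun _ _ => True)].
Qed.

Lemma definable_all_rel (P : (nat -> nat -> Prop) -> (nat -> std) -> Prop) :
  definable (fun e => P (e 0).2 (fun i => e i.+1)) ->
  definable (fun e => forall R, P R e).
Proof.
move=> /(definable_all (P := fun m => P m.2)); apply: definable_ext => e.
by split=> [H R|H [n r]]; [apply: (H (0, R))|apply: H].
Qed.

Lemma definable_app r x y : definable (fun e => (e r).2 (e x).1 (e y).1).
Proof. by exists (FApp r x y). Qed.

Lemma definable_succ x y : definable (fun e => (e y).1 = (e x).1.+1).
Proof. by exists (FSucc x y). Qed.

Lemma definable_zero x : definable (fun e => (e x).1 = 0).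
Proof. by exists (zero_fo x) => e; exact: std_zero. Qed.

Lemma definable_eq x y : definable (fun e => (e x).1 = (e y).1).
Proof. by exists (eqv_fo x y) => e; exact: std_eqv. Qed.

(** Unnesting: the language has no terms, so the value of [t] is named by a fresh quantified
    variable. *)
Lemma definable_let (t : (nat -> std) -> nat) (P : nat -> (nat -> std) -> Prop) :
  definable (fun e => (e 0).1 = t (fun i => e i.+1)) ->
  definable (fun e => P (e 0).1 (fun i => e i.+1)) ->
  definable (fun e => P (t e) e).
Proof.
move=> deft defP.
apply: (@definable_ext (fun e => exists n, n = t e /\ P n e)).
  by move=> e; split=> [[_ [->]]|] //; exists (t e).
exact/definable_ex_num/definable_and.
Qed.

Lemma definable_const x n : definable (fun e => (e x).1 = n).
Proof.
elim: n x => [|n IHn] x; first exact: definable_zero.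
apply: (definable_let (t := fun=> n) (P := fun m e => (e x).1 = m.+1)) => //.
exact: definable_succ.
Qed.

Lemma definable_forall_in (I : eqType) (s : seq I) (P : I -> (nat -> std) -> Prop) :
  (forall i, definable (P i)) -> definable (fun e => forall i, i \in s -> P i e).
Proof.
move=> defP; elim: s => [|i s IHs].
  apply: (@definable_ext (fun e => (e 0).1 = (e 0).1)); last exact: definable_eq.
  by move=> e.
apply: (definable_ext _ (definable_and (defP i) IHs)) => e; split=> [[Pi Ps] j|H].
  by rewrite inE => /predU1P[->|/Ps].
by split=> [|j js]; apply: H; rewrite inE ?eqxx // js orbT.
Qed.

Definition push (us : seq std) (e : nat -> std) : nat -> std := foldr (@scons std) e us.

Lemma push_nth us e d i : push us e i = if i < size us then nth d us i else e (i - size us).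
Proof. by elim: us i => [|u us IHus] [|i] //=; rewrite ?subn0 // IHus. Qed.

Lemma definable_ex_seq k Q :
  definable Q -> definable (fun e => exists2 us, size us = k & Q (push us e)).
Proof.
elim: k Q => [|k IHk] Q defQ.
  apply: (definable_ext _ defQ) => e; split=> [|[us /size0nil ->]] //.
  by exists [::].
(* The outermost quantifier supplies the last entry of the list, since [push] places the head at
   index 0. *)
have {IHk} [f fP] := IHk _ defQ; exists (FEx f) => e /=; split=> [[m /fP[us us_k HQ]]|[us us_k]].
  by exists (rcons us m); rewrite ?size_rcons ?us_k // /push foldr_rcons.
case: (lastP us) us_k => // {us}us m; rewrite size_rcons => -[us_k] HQ.
by exists m; apply/fP; exists us; rewrite // /push -foldr_rcons.
Qed.

(* The graph of primitive recursion is the least relation closed under the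
   recursion equations. *)
Definition rec_graph (B : nat -> Prop) (H : nat -> nat -> nat -> Prop) m v : Prop :=
  forall R : nat -> nat -> Prop,
    (forall w, B w -> R 0 w) ->
    (forall i w w', R i w -> H i w w' -> R i.+1 w') ->
    R m v.

Lemma prec_graphE n F H (t : n.-tuple nat) m v :
  prec_graph F H t m v <-> rec_graph (F t) (fun i w => H [tuple of i :: w :: t]) m v.
Proof.
split=> [|/(_ (prec_graph F H t))]; last by apply=> // i w w' iw Hw; exists w.
move=> mv R RB RH; elim: m v mv => [|m IHm] v /=; first exact: RB.
by move=> [w /IHm mw]; apply: RH.
Qed.

Lemma rec_graph_funE b h m v :
  rec_graph (fun w => w = b) (fun i w w' => w' = h i w) m v <->
  v = nat_rect (fun=> nat) b h m.
Proof.
split=> [/(_ (fun i w => w = nat_rect (fun=> nat) b h i))|-> R RB RH].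
  by apply=> // i w w' -> ->.
by elim: m => [|m IHm] /=; [apply: RB|apply: RH IHm _].
Qed.

(** The shift by 2 counts the binders of [R] and [w] in the base clause of [rec_graph]; the shift by
    4 counts [R], [i], [w], [w'] in the step clause. *)
Lemma definable_rec (B : (nat -> std) -> nat -> Prop)
    (H : (nat -> std) -> nat -> nat -> nat -> Prop) x y :
  definable (fun e => B (fun i => e i.+2) (e 0).1) ->
  definable (fun e => H (fun i => e i.+4) (e 2).1 (e 1).1 (e 0).1) ->
  definable (fun e => rec_graph (B e) (H e) (e x).1 (e y).1).
Proof.
move=> defB defH; apply: definable_all_rel; apply: definable_imp.
  apply: definable_all_num; apply: definable_imp defB _.
  apply: (definable_let (t := fun=> 0) (P := fun n e => (e 1).2 n (e 0).1)).
    exact: definable_zero.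
  exact: definable_app.
apply: definable_imp; last exact: (definable_app 0 x.+1 y.+1).
do 3!apply: definable_all_num; apply: definable_imp; first exact: (definable_app 3).
apply: definable_imp => //.
apply: (definable_let (t := fun e => (e 2).1.+1) (P := fun n e => (e 3).2 n (e 0).1)).
  exact: definable_succ.
exact: definable_app.
Qed.

(** [r] allocates variables to arguments; the induction on programs generalizes over it, as binders
    move the variables. *)
Definition args n (r : 'I_n -> nat) (e : nat -> std) : n.-tuple nat :=
  [tuple (e (r i)).1 | i < n].

Lemma args_cons n (r : 'I_n -> nat) e x :
  [tuple of (e x).1 :: args r e] = args (fun i => oapp r x (unlift ord0 i)) e.
Proof.
apply: eq_from_tnth => i; rewrite tnth_mktuple.
case: (unliftP ord0 i) => [j ->|->] /=; last by rewrite tnth0.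
by rewrite tnthS tnth_mktuple.
Qed.

Lemma definable_meval n (c : murec n) (r : 'I_n -> nat) y :
  definable (fun e => meval c (args r e) (e y).1).
Proof.
elim: c r y => {n} [n|/=|n i|n k f IHf g IHg|n f IHf h IHh|n f IHf] r y /=.
- exact: definable_zero.
- apply: definable_ext (definable_succ (r ord0) y) => e.
  by rewrite /thead tnth_mktuple.
- by apply: definable_ext (definable_eq y (r i)) => e; rewrite tnth_mktuple.
(* The [k] intermediate values occupy the variables below [k] and shift all others by [k]. *)
- have defQ : definable (fun e =>
      (forall i : 'I_k, meval (g i) (args (fun j => r j + k) e) (e i).1) /\
      meval f (args (@nat_of_ord k) e) (e (y + k)).1).
    apply: definable_and => //.
    apply: definable_ext (definable_forall_in (enum 'I_k) (fun i => IHg i (fun j => r j + k) i)).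
    by move=> e; split=> H i; [|move=> _]; apply: H; rewrite mem_enum.
  apply: (definable_ext _ (definable_ex_seq k defQ)) => e.
  have pushr us i : size us = k -> push us e (i + k) = e i.
    by move=> us_k; rewrite (push_nth _ _ (e 0)) us_k ltnNge leq_addl addnK.
  have argsr us : size us = k -> args (fun j => r j + k) (push us e) = args r e.
    by move=> us_k; apply: eq_from_tnth => j; rewrite !tnth_mktuple pushr.
  split=> [[us us_k [gP fP]]|[u gP fP]].
    exists (args (@nat_of_ord k) (push us e)) => [i|].
      by rewrite tnth_mktuple -(argsr us).
    by rewrite -(pushr us).
  pose us : seq std := [seq (n, fun _ _ => True) | n <- u].
  have us_k : size us = k by rewrite size_map size_tuple.
  have us_nth (i : 'I_k) : (push us e i).1 = tnth u i.
    rewrite (push_nth _ _ (0, fun _ _ => True)) us_k ltn_ord (nth_map 0) ?size_tuple //=.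
    by rewrite -tnth_nth.
  exists us => //; split=> [i|]; first by rewrite argsr // us_nth.
  rewrite pushr //; congr (meval f _ _) : fP.
  by apply: eq_from_tnth => i; rewrite tnth_mktuple us_nth.
- pose r' i := r (lift ord0 i).
  apply: (@definable_ext (fun e => rec_graph (meval f (args r' e))
     (fun i w => meval h [tuple of i :: w :: args r' e]) (e (r ord0)).1 (e y).1)).
    move=> e; rewrite -prec_graphE /thead tnth_mktuple.
    suff -> : behead_tuple (args r e) = args r' e by [].
    apply: eq_from_tnth => i; rewrite tnth_behead !tnth_mktuple /r'; congr (e (r _)).1.
    by apply: val_inj; rewrite /= inordK // ltnS.
  apply: (definable_rec (B := fun e => meval f (args r' e))
           (H := fun e i w => meval h [tuple of i :: w :: args r' e])).
    exact: (IHf (fun i => (r' i).+2)).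
  (* Below the binders of the step clause, variable 1 is the previous value, variable 2 the
     recursion index, and the parameters are shifted by 4. *)
  pose r1 i := oapp (fun j => (r' j).+4) 1 (unlift ord0 i).
  apply: definable_ext (IHh (fun i => oapp r1 2 (unlift ord0 i)) 0) => e.
  rewrite -!args_cons; suff -> : [tuple of (e 2).1 :: [tuple of (e 1).1 :: args (fun j => (r' j).+4) e]] =
    [tuple of (e 2).1 :: (e 1).1 :: args (fun j => (r' j).+4) e] by [].
  exact: val_inj.
- apply: definable_and.
    apply: (definable_let (t := fun=> 0)
              (P := fun z e => meval f [tuple of (e y).1 :: args r e] z)).
      exact: definable_zero.
    by apply: definable_ext (IHf (fun i => oapp (fun j => (r j).+1) y.+1 (unlift ord0 i)) 0) => e; rewrite -args_cons.
  apply: definable_all_num; apply: definable_imp.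
    (* The order is not atomic: [m < v] says that [v] lies in every set that contains [m.+1] and is
       closed under successor. *)
    pose R_closed := fun e : nat -> std => forall R : nat -> nat -> Prop,
      (forall w, w = (e 0).1.+1 -> R w w) -> (forall w w', R w w -> w' = w.+1 -> R w' w') ->
      R (e y.+1).1 (e y.+1).1.
    apply: (@definable_ext R_closed) => [e|].
      split=> [/(_ (fun w _ => (e 0).1 < w))|lt_y R R0 RS]; first by apply=> [w ->|w w' ? ->] //; apply: ltnW.
      move: lt_y; elim: (e y.+1).1 => // w IHw; rewrite ltnS leq_eqVlt => /predU1P[<-|/IHw Rw].
        exact: R0.
      exact: RS Rw _.
    apply: definable_all_rel; apply: definable_imp.
      apply: definable_all_num; apply: definable_imp; first exact: (definable_succ 2 0).
      exact: (definable_app 1 0 0).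
    apply: definable_imp; last exact: (definable_app 0 y.+2 y.+2).
    do 2!apply: definable_all_num; apply: definable_imp; first exact: (definable_app 2 1 1).
    apply: definable_imp; [exact: (definable_succ 1 0)|exact: (definable_app 2 0 0)].
  apply: definable_ex_num.
  apply: (definable_let (t := fun e => (e 0).1.+1) (P := fun z e =>
            meval f [tuple of (e 1).1 :: args r (fun i => e i.+2)] z)).
    exact: definable_succ.
  apply: definable_ext (IHf (fun i => oapp (fun j => (r j).+3) 2 (unlift ord0 i)) 0) => e.
  by rewrite -args_cons.
Qed.

End Closure.

(** One universal quantifier over relations governs conditions on graphs of programs; the infinitely
    many premises of a rule cost only numerical quantifiers. *)
Lemma definable_in_least_closed (ax : murec 1) (ru : murec 2) (pr : murec 3) x :
  definable (fun e => in_least_closed ax ru pr (e x).1).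
Proof.
have defv n (c : murec n) (s : n.-tuple nat) y :
    definable (fun e => meval c (map_tuple (fun i => (e i).1) s) (e y).1).
  apply: definable_ext (definable_meval c (tnth s) y) => e.
  suff -> : args (tnth s) e = map_tuple (fun i => (e i).1) s by [].
  by apply: eq_from_tnth => i; rewrite tnth_mktuple tnth_map.
have defax n y : definable (fun e => meval ax [tuple (e n).1] (e y).1).
  apply: definable_ext (defv _ ax [tuple n] y) => e.
  suff -> : map_tuple (fun i => (e i).1) [tuple n] = [tuple (e n).1] by [].
  exact: val_inj.
have defru k n y : definable (fun e => meval ru [tuple (e k).1; (e n).1] (e y).1).
  apply: definable_ext (defv _ ru [tuple k; n] y) => e.
  suff -> : map_tuple (fun i => (e i).1) [tuple k; n] = [tuple (e k).1; (e n).1] by [].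
  exact: val_inj.
have defpr k n j y :
    definable (fun e => meval pr [tuple (e k).1; (e n).1; (e j).1] (e y).1).
  apply: definable_ext (defv _ pr [tuple k; n; j] y) => e.
  suff -> : map_tuple (fun i => (e i).1) [tuple k; n; j] = [tuple (e k).1; (e n).1; (e j).1] by [].
  exact: val_inj.
apply: definable_all_rel; apply: definable_imp.
  apply: definable_all_num; apply: definable_imp; last exact: (definable_app 1 0 0).
  by apply: definable_ex_num; apply: defax.
apply: definable_imp; last exact: (definable_app 0 x.+1 x.+1).
do 2!apply: definable_all_num; apply: definable_imp.
  by apply: definable_ex_num; apply: defru.
apply: definable_imp; last exact: (definable_app 2 0 0).
do 2!apply: definable_all_num; apply: definable_imp; last exact: (definable_app 4 0 0).
exact: defpr.
Qed.

(** * Definability of the functions used in coding *)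

Definition definable_fun (f : nat -> nat) : Prop :=
  forall x y, definable (fun e => (e y).1 = f (e x).1).

Lemma definable_fun_comp f g :
  definable_fun f -> definable_fun g -> definable_fun (f \o g).
Proof.
move=> deff defg x y.
apply: (definable_let (t := fun e => g (e x).1) (P := fun n e => (e y).1 = f n)).
  exact: defg.
exact: deff.
Qed.

Lemma definable_comp_pred f (P : nat -> Prop) x :
  definable_fun f -> definable (fun e => P (e 0).1) ->
  definable (fun e => P (f (e x).1)).
Proof.
move=> deff defP.
exact: (definable_let (t := fun e => f (e x).1) (P := fun n _ => P n)).
Qed.

Lemma definable_nat_rect (b : (nat -> std) -> nat) (h : (nat -> std) -> nat -> nat -> nat) x y :
  definable (fun e => (e 0).1 = b (fun i => e i.+2)) ->
  definable (fun e => (e 0).1 = h (fun i => e i.+4) (e 2).1 (e 1).1) ->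
  definable (fun e => (e y).1 = nat_rect (fun=> nat) (b e) (h e) (e x).1).
Proof.
move=> defb defh.
apply: (definable_ext _ (definable_rec (B := fun e w => w = b e)
   (H := fun e i w w' => w' = h e i w) x y defb defh)) => e.
exact: rec_graph_funE.
Qed.

Lemma definable_add x y z : definable (fun e => (e z).1 = (e x).1 + (e y).1).
Proof.
apply: (@definable_ext (fun e => (e z).1 =
  nat_rect (fun=> nat) (e y).1 (fun _ w => w.+1) (e x).1)).
  move=> e; suff -> : nat_rect (fun=> nat) (e y).1 (fun _ w => w.+1) (e x).1 = (e x).1 + (e y).1 by [].
  by elim: (e x).1 => //= n ->.
apply: (definable_nat_rect (b := fun e => (e y).1) (h := fun _ _ w => w.+1)).
  exact: definable_eq.
exact: definable_succ.
Qed.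

Lemma definable_pair_code x y z :
  definable (fun e => (e z).1 = pair_code (e x).1 (e y).1).
Proof.
(* Triangular numbers: the Cantor code of [(x, y)] is [y + tri (y + x)]. *)
pose tri := nat_rect (fun=> nat) 0 (fun i m => i.+1 + m).
have deftri : definable_fun tri.
  move=> {}x {}y; apply: (definable_nat_rect (b := fun=> 0) (h := fun _ i m => i.+1 + m)).
    exact: definable_zero.
  apply: (definable_let (t := fun e => (e 2).1.+1) (P := fun n e => (e 0).1 = n + (e 1).1)).
    exact: definable_succ.
  exact: definable_add.
apply: (definable_let (t := fun e => (e y).1 + (e x).1)
   (P := fun n e => (e z).1 = (e y).1 + tri n)); first exact: definable_add.
apply: (definable_let (t := fun e => tri (e 0).1)
   (P := fun n e => (e z.+1).1 = (e y.+1).1 + n)); first exact: deftri.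
exact: definable_add.
Qed.

Lemma definable_fun_pair_code k : definable_fun (pair_code k).
Proof.
move=> x y; apply: (definable_let (t := fun=> k) (P := fun n e => (e y).1 = pair_code n (e x).1)).
  exact: definable_const.
exact: definable_pair_code.
Qed.

Lemma definable_fun_iter_diag f : definable_fun f -> definable_fun (fun n => iter n f n).
Proof.
move=> deff x y.
apply: (@definable_ext (fun e => (e y).1 =
  nat_rect (fun=> nat) (e x).1 (fun _ w => f w) (e x).1)).
  move=> e; suff iterE n b : nat_rect (fun=> nat) b (fun _ w => f w) n = iter n f b by rewrite iterE.
  by elim: n => //= n ->.
apply: (definable_nat_rect (b := fun e => (e x).1) (h := fun _ _ w => f w)).
  exact: definable_eq.
exact: deff.
Qed.

(** * Plays *)

Section Plays.
Variables (S : signature) (G : cgs S).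
Implicit Types (s t : state G) (chi : assignment G).

Lemma chain_rcons s p t : chain s (rcons p t) <-> chain s p /\ step (last s p) t.
Proof.
elim: p s => [|u p IHp] s /=; first by tauto.
by rewrite IHp; tauto.
Qed.

Lemma shift_total s t (f : strategy G) :
  step s t -> total_strategy s f -> total_strategy t (shift [:: s; t] f).
Proof.
move=> st [f_track f_total]; split=> [[|u rho] //=|[|u rho] [//= ch] [eq_u]].
  by rewrite /shift /=; case: eqP => // <- /f_track[].
by subst u; rewrite /shift /= eqxx; apply: f_total.
Qed.

Lemma prefix_uptoS (pi : nat -> state G) n :
  prefix_upto pi n.+1 = rcons (prefix_upto pi n) (pi n.+1).
Proof. by rewrite /prefix_upto mkseqS. Qed.

Definition complete_total chi s : Prop :=
  forall a, exists2 f, chi (inr a) = Some f & total_strategy s f.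

Definition is_move chi (rho : seq (state G)) (delta : {ffun agents S -> action G}) : Prop :=
  forall a, obind (fun f => f rho) (chi (inr a)) = Some (delta a).

Lemma moveP chi s rho : complete_total chi s -> track_from s rho ->
  exists delta, is_move chi rho delta.
Proof.
move=> chi_total rho_s; have [ac] := action_nonempty G.
pose mv a := odflt ac (obind (fun f => f rho) (chi (inr a))).
exists [ffun a => mv a] => a; rewrite ffunE /mv.
by have [f -> [_ /(_ rho rho_s)]] := chi_total a; rewrite /=; case: (f rho).
Qed.

(** Decisions are chosen as a function of the history, and iterating the choice extends the history
    state by state. *)
Lemma play_exists chi s : complete_total chi s -> exists pi, is_play chi s pi.
Proof.
move=> chi_total.
have /choice[next nextP] rho : exists delta, track_from s rho -> is_move chi rho delta.
  have [rho_s|not_rho] := pselect (track_from s rho).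
    by have [delta] := moveP chi_total rho_s; exists delta.
  by have [ac] := action_nonempty G; exists [ffun=> ac].
pose hist := fix hist n := if n is n'.+1 then
  rcons (hist n') (trans (last s (hist n')) (next (hist n'))) else [:: s].
pose pi n := last s (hist n).
have histE n : prefix_upto pi n = hist n.
  by elim: n => // n IHn; rewrite prefix_uptoS IHn /pi /= last_rcons.
have hist_track n : track_from s (hist n).
  elim: n => // n [IHn hd]; case eq_h: (hist n) IHn hd => [|u h] //= ch [eq_u].
  rewrite eq_h /=; split; rewrite ?eq_u //= -{1}eq_u; apply/chain_rcons; split=> //.
  by rewrite eq_u; eexists.
exists pi; split=> // n; exists (next (hist n)); rewrite histE; split; first exact: nextP.
by rewrite /pi /= last_rcons.
Qed.

(** Only the first round matters: [chi] determines its decision, and some play exists by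
    [play_exists]. *)
Lemma sat_next chi s psi : complete_total chi s ->
  sat chi s (Next psi) <->
  exists2 delta, is_move chi [:: s] delta &
    let t := trans s delta in sat (shift_assignment [:: s; t] chi) t psi.
Proof.
have prefix0 (pi : nat -> state G) : prefix_upto pi 0 = [:: pi 0] by [].
have prefix1 (pi : nat -> state G) : prefix_upto pi 1 = [:: pi 0; pi 1] by [].
move=> chi_total; split=> [[pi [pi0 piS]]|[delta delta_s H]].
  have [delta []] := piS 0; rewrite prefix1 prefix0 pi0 => delta_s -> H.
  by exists delta.
have [pi pi_play] := play_exists chi_total; exists pi => //.
have [pi0 /(_ 0)[delta' []]] := pi_play; rewrite prefix1 prefix0 pi0 => delta'_s ->.
suff -> : delta' = delta by [].
by apply/ffunP => a; have := delta'_s a; rewrite delta_s => -[].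
Qed.

End Plays.

(** * Interpretation of first-order formulas in Strategy Logic *)

Lemma fset01_neq0 : ([fset 0; 1] != fset0 :> {fset nat})%fset.
Proof. by apply/fset0Pn; exists 0; rewrite fset21. Qed.

Lemma fset0_neq0 : ([fset 0] != fset0 :> {fset nat})%fset.
Proof. by apply/fset0Pn; exists 0; rewrite fset11. Qed.

Definition sig2 : signature := Signature fset0_neq0 fset01_neq0.
Definition prop0 : props sig2 := FSetSub (fset11 0).
Definition agent0 : agents sig2 := FSetSub (fset21 0 1).
Definition agent1 : agents sig2 := FSetSub (fset22 0 1).

Lemma agent01P (a : agents sig2) : a = agent0 \/ a = agent1.
Proof.
by case: a => i i_ag; case/fset2P: (i_ag) => ei; [left|right]; apply: val_inj.
Qed.

(* In the first round the two agents play the individuals x and y, reaching a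
   state that stands for the pair; there r answers whether the pair belongs to
   it, by making the proposition true or false in the next state. *)
Definition app_sl (r x y : nat) : formula sig2 :=
  Bind agent0 x (Bind agent1 y (Next (Bind agent0 r (Bind agent1 r (Next (Atom prop0)))))).

(* At level k, the name [i] <= k stands for the de Bruijn index k - i, and [0]
   also stands for all the indices beyond k. *)
Fixpoint to_sl (k : nat) (f : fo) : formula sig2 :=
  match f with
  | FApp r x y => app_sl (k - r) (k - x) (k - y)
  | FSucc x y => app_sl 0 (k - x) (k - y)
  | FNot f1 => Not (to_sl k f1)
  | FAnd f1 f2 => And (to_sl k f1) (to_sl k f2)
  | FImp f1 f2 => Or (Not (to_sl k f1)) (to_sl k f2)
  | FAll f1 => ForallStr k.+1 (to_sl k.+1 f1)
  | FEx f1 => ExistsStr k.+1 (to_sl k.+1 f1)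
  end.

Definition assign_agents (G : cgs sig2) (chi : assignment G) (f g : option (strategy G)) :
  assignment G :=
  fun l => match l with
  | inl _ => chi l
  | inr a => if a == agent0 then f else g
  end.

(** [Next] makes both agents free, so both bindings take effect and erase earlier assignments of the
    agents. *)
Lemma sat_bind2 (G : cgs sig2) (chi : assignment G) s x y psi :
  sat chi s (Bind agent0 x (Bind agent1 y (Next psi))) =
  sat (assign_agents chi (chi (inl x)) (chi (inl y))) s (Next psi).
Proof.
have -> : assign_agents chi (chi (inl x)) (chi (inl y)) =
    update (update chi (inr agent0) (chi (inl x))) (inr agent1)
      (update chi (inr agent0) (chi (inl x)) (inl y)).
  by apply/funext => -[v|a] //; case: (agent01P a) => ->.
by [].
Qed.

Section Interpretation.
Variables (G : cgs sig2) (s : state G).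

Definition tstrategy := {f : strategy G | total_strategy s f}.

Definition play_pair (m n : action G) : {ffun agents sig2 -> action G} :=
  [ffun a => if a == agent0 then m else n].

Definition first_move (x : tstrategy) (m : action G) : Prop :=
  sval x [:: s] = Some m.

Definition app_cgs (r x y : tstrategy) : Prop :=
  exists m n, [/\ first_move x m, first_move y n &
    let t := trans s (play_pair m n) in
    exists2 c, sval r [:: s; t] = Some c &
      prop0 \in labeling (trans t (play_pair c c))].

Lemma first_move_ex (x : tstrategy) : exists m, first_move x m.
Proof.
case: x => f [? f_total]; rewrite /first_move /=.
by have := f_total [:: s] (conj I erefl); case: (f _) => // m; exists m.
Qed.

Lemma first_move_fun x m n : first_move x m -> first_move x n -> m = n.
Proof. by rewrite /first_move => -> []. Qed.

Lemma is_move_play_pair (t : state G) chi (f g : strategy G) m n delta :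
  f [:: t] = Some m -> g [:: t] = Some n ->
  is_move (assign_agents chi (Some f) (Some g)) [:: t] delta <-> delta = play_pair m n.
Proof.
move=> fm gn; split=> [H|-> a]; last by rewrite ffunE /=; case: eqP.
apply/ffunP => a; have := H a; rewrite ffunE /=.
by case: eqP => _ /=; rewrite ?fm ?gn => -[].
Qed.

Lemma sat_assign_next (t : state G) chi (f g : strategy G) m n psi :
  total_strategy t f -> total_strategy t g -> f [:: t] = Some m -> g [:: t] = Some n ->
  let chi' := assign_agents chi (Some f) (Some g) in
  let u := trans t (play_pair m n) in
  sat chi' t (Next psi) <-> sat (shift_assignment [:: t; u] chi') u psi.
Proof.
move=> f_total g_total fm gn chi' u; rewrite sat_next; last first.
  by move=> a /=; case: eqP => _; [exists f|exists g].
split=> [[delta /(is_move_play_pair _ _ fm gn) ->] //|H].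
by exists (play_pair m n); first exact/(is_move_play_pair _ _ fm gn).
Qed.

(** In the second round both agents follow the shifted [r], which answers at [[:: t]] what [r]
    answers at [[:: s; t]]. *)
Lemma sat_app_sl chi r x y (r' x' y' : tstrategy) :
  chi (inl r) = Some (sval r') -> chi (inl x) = Some (sval x') ->
  chi (inl y) = Some (sval y') ->
  (sat chi s (app_sl r x y) <-> app_cgs r' x' y').
Proof.
move=> chir chix chiy; have [m xm] := first_move_ex x'; have [n yn] := first_move_ex y'.
pose t := trans s (play_pair m n).
have r_total : total_strategy t (shift [:: s; t] (sval r')).
  by apply: shift_total (svalP r'); exists (play_pair m n).
have [c rc] : exists c, sval r' [:: s; t] = Some c.
  have [_ /(_ [:: t] (conj I erefl))] := r_total; rewrite /shift /= eqxx /=.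
  by case: (sval r' _) => // c; exists c.
have sh_rc : shift [:: s; t] (sval r') [:: t] = Some c by rewrite /shift /= eqxx.
rewrite /app_sl sat_bind2 chix chiy (sat_assign_next _ _ (svalP x') (svalP y') xm yn).
have shr : shift_assignment [:: s; t] (assign_agents chi (Some (sval x')) (Some (sval y')))
    (inl r) = Some (shift [:: s; t] (sval r')) by rewrite /shift_assignment /= chir.
rewrite -/t sat_bind2 shr (sat_assign_next _ _ r_total r_total sh_rc sh_rc) /=.
split=> [tp|[m' [n' [/(first_move_fun xm) <- /(first_move_fun yn) <-]]]].
  by exists m, n; split=> //; exists c.
by move=> [c' /=]; rewrite -/t rc => -[->].
Qed.

(** A strategy may answer differently in each state: it copies the full relation in the states
    reached by pairs in [Q] and the empty relation elsewhere. *)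
Lemma relation_full_cgs : relation_full app_cgs.
Proof.
move=> [all_r allP] [no_r noP] Q Q_inv.
pose pairs t := exists x y m n, [/\ first_move x m, first_move y n,
  t = trans s (play_pair m n) & Q x y].
pose sel (rho : seq (state G)) := if rho is [:: _; t] then `[< pairs t >] else false.
pose f rho := if sel rho then sval all_r rho else sval no_r rho.
have f_total : total_strategy s f.
  have [a1 a2] := svalP all_r; have [n1 n2] := svalP no_r.
  by split=> rho; rewrite /f; case: ifP => _; [apply: a1|apply: n1|apply: a2|apply: n2].
exists (exist _ f f_total) => x y; split=> [[m [n [xm yn /=]]]|Qxy].
  rewrite /f /=; case: asboolP => [[x' [y' [m' [n' [xm' yn' eq_t Qxy']]]]] _|_ pt]; last first.
    by case: (noP x y); exists m, n.
  (* Pairs that lead to the same state are separated by no relation, so [Q] passes from the pair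
     found to the given one. *)
  apply: Q_inv Qxy' => r; split=> -[m1 [n1 [/first_move_fun e1 /first_move_fun e2 H]]];
    [exists m, n|exists m', n']; split=> //.
  - by move: H; rewrite (e1 _ xm') (e2 _ yn') -eq_t.
  - by move: H; rewrite (e1 _ xm) (e2 _ yn) eq_t.
have [m [n [xm yn pt]]] := allP x y; exists m, n; split=> //=.
rewrite /f /=; case: asboolP => // -[].
by exists x, y, m, n.
Qed.

Lemma sat_to_sl_cgs sgm k chi e f :
  chi (inl 0) = Some (sval sgm) ->
  (forall i, chi (inl (k - i)) = Some (sval (e i))) ->
  (sat chi s (to_sl k f) <-> eval app_cgs sgm e f).
Proof.
have upd0 j chi' g : chi' (inl 0) = Some (sval sgm) ->
  update chi' (inl j.+1) g (inl 0) = Some (sval sgm) by [].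
have upd_scons j chi' (e' : nat -> tstrategy) (x : tstrategy) :
    (forall i, chi' (inl (j - i)) = Some (sval (e' i))) ->
    forall i, update chi' (inl j.+1) (Some (sval x)) (inl (j.+1 - i)) =
              Some (sval (scons x e' i)).
  move=> He' [|i]; rewrite /update /= ?subn0 ?eqxx // subSS He'.
  (* The new name [j.+1] exceeds every [j - i], so binding it leaves the older names intact. *)
  by case: eqP => // -[] /eqP; rewrite ltn_eqF // ltnS leq_subr.
elim: f k chi e => [r x y|x y|f IHf|f IHf g IHg|f IHf g IHg|f IHf|f IHf] k chi e chi0 He.
- exact: sat_app_sl.
- exact: sat_app_sl.
- by rewrite /= (IHf _ _ _ chi0 He).
- by rewrite /= (IHf _ _ _ chi0 He) (IHg _ _ _ chi0 He).
- by rewrite /= (IHf _ _ _ chi0 He) (IHg _ _ _ chi0 He) orNp.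
- split=> H x.
    exact: (iffLR (IHf _ _ _ (upd0 _ _ _ chi0) (upd_scons _ _ _ x He)) (H _ (svalP x))).
  by move=> x_total; apply: (iffRL (IHf _ _ _ (upd0 _ _ _ chi0)
    (upd_scons _ _ _ (exist _ x x_total) He)) (H _)).
- split=> [[x x_total H]|[x H]].
    by exists (exist _ x x_total); apply: (iffLR (IHf _ _ _ (upd0 _ _ _ chi0)
      (upd_scons _ _ _ (exist _ x x_total) He)) H).
  exists (sval x); first exact: svalP.
  exact: (iffRL (IHf _ _ _ (upd0 _ _ _ chi0) (upd_scons _ _ _ x He)) H).
Qed.

Lemma sat_to_sl sgm I k chi e f :
  bisimulation app_cgs sgm I -> chi (inl 0) = Some (sval sgm) ->
  (forall i, exists2 x, chi (inl (k - i)) = Some (sval x) & I x (e i)) ->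
  (sat chi s (to_sl k f) <-> eval std_app std_succ e f).
Proof.
move=> B chi0 He.
have /choice[e' e'P] i : exists x, chi (inl (k - i)) = Some (sval x) /\ I x (e i).
  by have [x] := He i; exists x.
rewrite (sat_to_sl_cgs _ chi0 (fun i => (e'P i).1)).
by apply: (eval_bisim B) => i; have [] := e'P i.
Qed.

End Interpretation.

(** * A concurrent game structure interpreting the standard structure *)

(** The initial state, one state for each pair of numbers, and two absorbing states that record the
    answer; action 0 means yes. *)
Definition arith_state : Type := option (nat * nat + bool).

Definition arith_trans (t : arith_state) (delta : {ffun agents sig2 -> nat}) : arith_state :=
  match t with
  | None => Some (inl (delta agent0, delta agent1))
  | Some (inl _) => Some (inr (delta agent0 == 0))
  | Some (inr _) => t
  end.

Definition arith_cgs : cgs sig2 :=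
  @CGS sig2 nat (option (nat * nat + bool)%type) (inhabits 0) arith_trans
    (fun t => if t is Some (inr true) then setT else set0) None.

Definition arith_rel (x : tstrategy (init arith_cgs)) (x0 : std) : Prop :=
  first_move x x0.1 /\
  forall m n, sval x [:: None; Some (inl (m, n))] = Some 0 <-> x0.2 m n.

Lemma arith_rel_right x0 : exists x, arith_rel x x0.
Proof.
pose f (rho : seq (state arith_cgs)) : option (action arith_cgs) :=
  if `[< track rho >] then Some match rho with
    | [:: _; Some (inl (m, n))] => if `[< x0.2 m n >] then 0 else 1
    | _ => x0.1
    end else None.
have f_total : total_strategy (init arith_cgs) f.
  by split=> rho; rewrite /f; case: asboolP => // not_track [].
exists (exist _ f f_total); split; first by rewrite /first_move /= /f asboolT.
move=> m n /=; rewrite /f asboolT; last first.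
  split=> //; exists (@play_pair arith_cgs m n).
  by rewrite /= !ffunE.
by case: asboolP => x0mn; split.
Qed.

Lemma arith_app r r0 x x0 y y0 : arith_rel r r0 -> arith_rel x x0 -> arith_rel y y0 ->
  (app_cgs r x y <-> std_app r0 x0 y0).
Proof.
move=> [_ rP] [xP _] [yP _]; rewrite /std_app -rP.
have tE : @trans _ arith_cgs None (@play_pair arith_cgs x0.1 y0.1) = Some (inl (x0.1, y0.1)).
  by rewrite /= !ffunE.
split=> [[m [n [/(first_move_fun xP) <- /(first_move_fun yP) <-]]]|r_xy].
  move=> [c]; rewrite tE => rc; rewrite rc /= ffunE eqxx.
  by case: eqP => [->|] //=; rewrite inE.
exists x0.1, y0.1; split=> //; exists 0; first by rewrite tE.
by rewrite tE /= ffunE eqxx inE.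
Qed.

Lemma arith_bisimulation sgm : arith_rel sgm std_succ -> bisimulation (@app_cgs arith_cgs _) sgm arith_rel.
Proof.
move=> sgmP; split.
- move=> x; have [m xm] := first_move_ex x.
  by exists (m, fun i j => sval x [:: None; Some (inl (i, j))] = Some 0).
- exact: arith_rel_right.
- exact: arith_app.
- by move=> x x0 y y0; apply: arith_app.
Qed.

(** * The diagonal sentence *)

(* The variable 0 holds the successor relation and the variable 1 the argument
   n of [psi]; [step_sl psi] expresses psi(n + 1). *)
Definition step_sl (psi : formula sig2) : formula sig2 :=
  ExistsStr 2 (And (to_sl 2 (FSucc 1 0)) (ExistsStr 1 (And (to_sl 2 (eqv_fo 1 0)) psi))).

Definition wrap_sl (psi : formula sig2) : formula sig2 :=
  ForallStr 0 (Or (Not (to_sl 0 peano_fo)) (ExistsStr 1 (And (to_sl 1 (zero_fo 0)) psi))).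

Lemma sat_ex_and (G : cgs sig2) (s : state G) chi v f g :
  sat chi s (ExistsStr v (And f g)) <->
  exists x : tstrategy s, let chi' := update chi (inl v) (Some (sval x)) in
    sat chi' s f /\ sat chi' s g.
Proof.
split=> [[x x_total H]|[x H]]; first by exists (exist _ x x_total).
by exists (sval x); first exact: svalP.
Qed.

Section Expresses.
Variables (G : cgs sig2) (s : state G) (sgm : tstrategy s) (I : tstrategy s -> std -> Prop).
Hypothesis B : bisimulation (@app_cgs G s) sgm I.

Definition expresses (psi : formula sig2) (P : nat -> Prop) : Prop :=
  forall chi x x0, chi (inl 0) = Some (sval sgm) -> chi (inl 1) = Some (sval x) ->
    I x x0 -> (sat chi s psi <-> P x0.1).

Lemma expresses_to_sl f (P : nat -> Prop) :
  (forall e, eval std_app std_succ e f <-> P (e 0).1) -> expresses (to_sl 1 f) P.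
Proof.
move=> fP chi x x0 chi0 chi1 Ix; have [g Ig] := bisim_left B sgm.
(* All indices beyond 0 are read from variable 0, which holds [sgm], related to [g]. *)
rewrite (sat_to_sl (e := scons x0 (fun=> g)) _ B chi0) ?fP // => -[|i].
  by exists x.
by exists sgm.
Qed.

(** The successor is found in variable 2, then an equal number is bound to variable 1, so [psi]
    undergoes no substitution. *)
Lemma expresses_step psi P :
  expresses psi P -> expresses (step_sl psi) (fun n => P n.+1).
Proof.
move=> psiP chi x x0 chi0 chi1 Ix; have [g Ig] := bisim_left B sgm.
have lvl2 f chi' (x1 y1 : tstrategy s) x1' y1' :
    chi' (inl 0) = Some (sval sgm) -> chi' (inl 1) = Some (sval x1) ->
    chi' (inl 2) = Some (sval y1) -> I x1 x1' -> I y1 y1' ->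
    (sat chi' s (to_sl 2 f) <-> eval std_app std_succ (scons y1' (scons x1' (fun=> g))) f).
  move=> chi'0 chi'1 chi'2 Ix1 Iy1; apply: (sat_to_sl _ B chi'0) => -[|[|i]].
  - by exists y1.
  - by exists x1.
  - by exists sgm.
rewrite sat_ex_and; split=> [[y [xy /sat_ex_and[x' [yx' H]]]]|Px].
  have [y0 Iy] := bisim_left B y; have [x'0 Ix'] := bisim_left B x'.
  have /= eq_y := iffLR (lvl2 _ _ x y x0 y0 chi0 chi1 erefl Ix Iy) xy.
  have /std_eqv /= eq_x' := iffLR (lvl2 _ _ x' y x'0 y0 chi0 erefl erefl Ix' Iy) yx'.
  by rewrite -eq_y -eq_x'; apply: (iffLR (psiP _ x' x'0 chi0 erefl Ix')) H.
have [y Iy] := bisim_right B (x0.1.+1, fun _ _ => True); exists y; split.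
  exact: (iffRL (lvl2 (FSucc 1 0) _ x y x0 _ chi0 chi1 erefl Ix Iy)).
apply/sat_ex_and; exists y; split; last exact: (iffRL (psiP _ y _ chi0 erefl Iy)).
by apply: (iffRL (lvl2 (eqv_fo 1 0) _ y y _ _ chi0 erefl erefl Iy Iy)); apply/std_eqv.
Qed.

Lemma expresses_iter n psi P :
  expresses psi P -> expresses (iter n step_sl psi) (fun m => P (n + m)).
Proof.
move=> psiP; elim: n => [|n IHn] //=.
by move=> chi x x0 chi0 chi1 Ix; rewrite (expresses_step IHn chi0 chi1 Ix) addnS.
Qed.

Lemma sat_zero_psi chi psi P : chi (inl 0) = Some (sval sgm) -> expresses psi P ->
  (sat chi s (ExistsStr 1 (And (to_sl 1 (zero_fo 0)) psi)) <-> P 0).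
Proof.
move=> chi0 psiP; have zeroP := @expresses_to_sl (zero_fo 0) (fun n => n = 0) (fun e => std_zero (e 0)).
rewrite sat_ex_and; split=> [[x [x_zero H]]|P0].
  have [x0 Ix] := bisim_left B x.
  have <- := iffLR (zeroP _ x x0 chi0 erefl Ix) x_zero.
  exact: (iffLR (psiP _ x x0 chi0 erefl Ix) H).
have [x Ix] := bisim_right B (0, fun _ _ => True); exists x.
by split; [apply: (iffRL (zeroP _ x _ chi0 erefl Ix))|apply: (iffRL (psiP _ x _ chi0 erefl Ix))].
Qed.

End Expresses.

Lemma sat_peano (G : cgs sig2) (s : state G) chi (sgm : tstrategy s) :
  chi (inl 0) = Some (sval sgm) ->
  (sat chi s (to_sl 0 peano_fo) <-> peano (@app_cgs G s) sgm).
Proof.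
by move=> chi0; rewrite (sat_to_sl_cgs (e := fun=> sgm) _ chi0) ?eval_peano.
Qed.

(** Validity is tested in [arith_cgs]. Conversely, in any game, a strategy for which the Peano
    axioms hold yields a bisimulation with the standard structure. *)
Lemma valid_wrap n f (P : nat -> Prop) :
  (forall e, eval std_app std_succ e f <-> P (e 0).1) ->
  (valid (wrap_sl (iter n step_sl (to_sl 1 f))) <-> P n).
Proof.
move=> fP; split=> [val|Pn G].
  have [sgm sgmP] := arith_rel_right std_succ.
  have B := arith_bisimulation sgmP.
  have exP := sat_zero_psi B _ (expresses_iter B n (expresses_to_sl B fP)).
  have [|/(exP _ erefl)] := val arith_cgs _ (svalP sgm); last by rewrite addn0.
  case; apply/(sat_peano (sgm := sgm)) => //.
  have [_] := @eval_bisim _ _ _ _ B (fun=> sgm) (fun=> std_succ) peano_fo (fun=> sgmP).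
  by apply; apply: std_peano.
move=> g g_total; pose sgm : tstrategy (init G) := exist _ g g_total.
rewrite /= orNp => /(sat_peano (sgm := sgm) erefl) pa.
have B := peano_bisimulation pa (@relation_full_cgs _ _).
apply/(sat_zero_psi B erefl (expresses_iter B n (expresses_to_sl B fP))).
by rewrite addn0.
Qed.

(** * Free variables of the diagonal sentence *)

Definition free_below (k : nat) (psi : formula sig2) : Prop :=
  forall l, free psi l -> if l is inl v then v <= k else false.

Lemma free_below_app_sl k r x y :
  r <= k -> x <= k -> y <= k -> free_below k (app_sl r x y).
Proof.
move=> rk xk yk [v|a] /=; last by case: (agent01P a) => ->.
by rewrite !andbT orbb => /orP[/orP[]|] /eqP[->].
Qed.

Lemma free_below_to_sl k f : free_below k (to_sl k f).
Proof.
elim: f k => [r x y|x y|f IHf|f IHf g IHg|f IHf g IHg|f IHf|f IHf] k.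
- by apply: free_below_app_sl; rewrite leq_subr.
- by apply: free_below_app_sl; rewrite ?leq_subr.
- exact: IHf.
- by move=> l /= /orP[/IHf|/IHg].
- by move=> l /= /orP[/IHf|/IHg].
- move=> l /= /andP[/IHf]; case: l => // v; rewrite leq_eqVlt => /orP[/eqP->|//].
  by rewrite eqxx.
- move=> l /= /andP[/IHf]; case: l => // v; rewrite leq_eqVlt => /orP[/eqP->|//].
  by rewrite eqxx.
Qed.

Lemma free_ex_and v (f g : formula sig2) l :
  free (ExistsStr v (And f g)) l = (free f l || free g l) && (l != inl v).
Proof. by []. Qed.

Lemma free_below_step psi : free_below 1 psi -> free_below 1 (step_sl psi).
Proof.
move=> psi1 l; rewrite /step_sl !free_ex_and.
move=> /andP[/orP[/(@free_below_to_sl 2 (FSucc 1 0) l)|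
  /andP[/orP[/(@free_below_to_sl 2 (eqv_fo 1 0) l)|/psi1]]]];
by case: l => // -[|[|[|v]]].
Qed.

Lemma sentence_wrap psi : free_below 1 psi -> sentence (wrap_sl psi).
Proof.
have freeE f g l : free (ForallStr 0 (Or (Not f) g)) l =
  (free f l || free g l) && (l != inl 0) :> bool by [].
move=> psi1 l; apply/negP; rewrite /wrap_sl freeE free_ex_and.
move=> /andP[/orP[/(@free_below_to_sl 0 peano_fo l)|
  /andP[/orP[/(@free_below_to_sl 1 (zero_fo 0) l)|/psi1]]]];
by case: l => // -[|[|v]].
Qed.

(** * Codes of the diagonal sentence and the contradiction *)

Definition step_code : nat -> nat :=
  pair_code 7 \o pair_code 2 \o pair_code 2 \o
  pair_code (formula_code (to_sl 2 (FSucc 1 0))) \o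
  pair_code 7 \o pair_code 1 \o pair_code 2 \o
  pair_code (formula_code (to_sl 2 (eqv_fo 1 0))).

Definition wrap_code : nat -> nat :=
  pair_code (pair_code (fset_code (props sig2)) (fset_code (agents sig2))) \o
  pair_code 8 \o pair_code 0 \o pair_code 3 \o
  pair_code (formula_code (Not (to_sl 0 peano_fo))) \o
  pair_code 7 \o pair_code 1 \o pair_code 2 \o
  pair_code (formula_code (to_sl 1 (zero_fo 0))).

(** The diagonal function: from the code of [psi] it computes the code of the sentence asserting
    [psi] of that code. Numerals arise by iteration instead of substitution, so only pairing and
    recursion are involved. *)
Definition diag_code (n : nat) : nat := wrap_code (iter n step_code n).

Lemma formula_code_ex_and S v (f g : formula S) :
  formula_code (ExistsStr v (And f g)) =
  pair_code 7 (pair_code v (pair_code 2 (pair_code (formula_code f) (formula_code g)))).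
Proof. by []. Qed.

Lemma formula_code_all_or S v (f g : formula S) :
  formula_code (ForallStr v (Or f g)) =
  pair_code 8 (pair_code v (pair_code 3 (pair_code (formula_code f) (formula_code g)))).
Proof. by []. Qed.

Lemma formula_code_step psi :
  formula_code (step_sl psi) = step_code (formula_code psi).
Proof.
rewrite /step_sl /step_code /comp.
(* Abstracting the fixed subformulas keeps their huge numerical codes from being computed. *)
move: (to_sl 2 (FSucc 1 0)) (to_sl 2 (eqv_fo 1 0)) => f g.
by rewrite !formula_code_ex_and.
Qed.

Lemma godel_wrap psi :
  godel (Tagged formula (wrap_sl psi)) = wrap_code (formula_code psi).
Proof.
rewrite /wrap_sl /wrap_code /comp.
move: (to_sl 0 peano_fo) (to_sl 1 (zero_fo 0)) => f g.
have godelE (phi : formula sig2) : godel (Tagged formula phi) =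
  pair_code (pair_code (fset_code (props sig2)) (fset_code (agents sig2)))
    (formula_code phi) by [].
by rewrite godelE formula_code_all_or formula_code_ex_and.
Qed.

Lemma godel_diag psi :
  godel (Tagged formula (wrap_sl (iter (formula_code psi) step_sl psi))) =
  diag_code (formula_code psi).
Proof.
rewrite godel_wrap /diag_code; congr wrap_code.
have iterE n : formula_code (iter n step_sl psi) = iter n step_code (formula_code psi).
  by elim: n => [//|n IHn]; rewrite !iterS formula_code_step IHn.
exact: iterE.
Qed.

Lemma definable_fun_diag : definable_fun diag_code.
Proof.
apply: (definable_fun_comp (f := wrap_code) (g := fun n => iter n step_code n)).
  by do !apply: definable_fun_comp; apply: definable_fun_pair_code.
apply: definable_fun_iter_diag.
by do !apply: definable_fun_comp; apply: definable_fun_pair_code.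
Qed.

Theorem mainTheorem2 :
  ~ exists E : effective_system,
      forall (S : signature) (phi : formula S),
        sentence phi ->
        (provable E (Tagged formula phi) <-> valid phi).
Proof.
move=> [E complete].
have [ax axP] := axiom_ce E; have [ru ruP] := rule_ce E.
have [pr prP] := premise_computable E.
(* [f] says of [n] that [diag_code n] lies outside the least closed set. *)
have [f fP] := definable_not (definable_comp_pred 0 definable_fun_diag
  (definable_in_least_closed ax ru pr 0)).
(* Taken at its own code [c], [psi] gives a sentence that is valid exactly when its code is not that
   of a provable formula. *)
pose psi := to_sl 1 f; pose c := formula_code psi.
have := complete _ _ (sentence_wrap (psi := iter c step_sl psi) _).
rewrite (provableP axP ruP prP) godel_diag.
rewrite (valid_wrap c (P := fun n => ~ in_least_closed ax ru pr (diag_code n))) //.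
rewrite -/c; case=> [|n np]; last by have := n; tauto.
by elim: c => [|n IHn]; [apply: free_below_to_sl|apply: free_below_step].
Qed.
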